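(* Let $r,s$ be positive integers, let $a_1,\dots,a_r,b_1,\dots,b_s,\alpha,\beta,z$ be as in the context, and write ${}_rR_{s,q}={}_rR_{s,q}(a_1,\dots,a_r;b_1,\dots,b_s;\alpha,\beta;z)$. Let $i\in\{1,\dots,r\}$ and $j\in\{1,\dots,s\}$. Then: (1) $$D_{z,q}\left[z^{a_i}{}_rR_{s,q}\right]=\frac{1-q^{a_i}}{1-q}z^{a_i-1}{}_rR_{s,q}+\frac{1-a_i}{(1-q)a_i}q^{a_i}z^{a_i-1}\left({}_rR_{s,q}(a_iq)-{}_rR_{s,q}\right)$$ $$=\frac{1-q^{a_i}}{1-q}z^{a_i-1}{}_rR_{s,q}+\frac{1-b_jq^{-1}}{(1-q)b_jq^{-1}}q^{a_i}z^{a_i-1}\left({}_rR_{s,q}(b_jq^{-1})-{}_rR_{s,q}\right);$$ (2) $$D_{z,q}\left[z^{a_i}{}_rR_{s,q}\right]=z^{a_i-1}\frac{1-a_i}{(1-q)a_i}\left({}_rR_{s,q}(a_iq)-{}_rR_{s,q}\right)+\frac{1-q^{a_i}}{1-q}z^{a_i-1}{}_rR_{s,q}(qz)$$ $$=z^{a_i-1}\frac{1-b_jq^{-1}}{(1-q)b_jq^{-1}}\left({}_rR_{s,q}(b_jq^{-1})-{}_rR_{s,q}\right)+\frac{1-q^{a_i}}{1-q}z^{a_i-1}{}_rR_{s,q}(qz);$$ (3) $$D_{z,q}\left[z^{b_j-1}{}_rR_{s,q}\right]=z^{b_j-2}\left[[b_j-1]_q\,{}_rR_{s,q}+\frac{(1-a_i)q^{b_j-1}}{(1-q)a_i}\left({}_rR_{s,q}(a_iq)-{}_rR_{s,q}\right)\right]$$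 $$=z^{b_j-2}\left[[b_j-1]_q\,{}_rR_{s,q}+\frac{(1-b_jq^{-1})q^{b_j-1}}{(1-q)b_jq^{-1}}\left({}_rR_{s,q}(b_jq^{-1})-{}_rR_{s,q}\right)\right];$$ (4) $$D_{z,q}\left[z^{b_j-1}{}_rR_{s,q}\right]=z^{b_j-2}\left[\frac{1-a_i}{(1-q)a_i}\left({}_rR_{s,q}(a_iq)-{}_rR_{s,q}\right)+[b_j-1]_q\,{}_rR_{s,q}(qz)\right]$$ $$=z^{b_j-2}\left[\frac{1-b_jq^{-1}}{(1-q)b_jq^{-1}}\left({}_rR_{s,q}(b_jq^{-1})-{}_rR_{s,q}\right)+[b_j-1]_q\,{}_rR_{s,q}(qz)\right].$$
   Context: Let $q\in\mathbb{C}$, $0<|q|<1$; complex powers are formed with fixed branches. $(a;q)_0=1$, $(a;q)_n=\prod_{i=0}^{n-1}(1-aq^i)$ for $n\ge1$, $(a;q)_\infty=\prod_{i\ge0}(1-aq^i)$, $[\mu]_q=\frac{1-q^\mu}{1-q}$. The $q$-gamma function is $\Gamma_q(x)=\frac{(q;q)_\infty}{(q^x;q)_\infty}(1-q)^{1-x}$, and $1/\Gamma_q(x)$ is read as $0$ at its poles. For complex parameters the basic function ${}_rR_{s,q}$ is $${}_rR_{s,q}(a_1,\dots,a_r;b_1,\dots,b_s;\alpha,\beta;z)=\sum_{\ell=0}^\infty\frac{z^\ell(-1)^{(1+s-r)\ell}q^{(1+s-r)\binom{\ell}{2}}}{(q;q)_\ell\,\Gamma_q(\ell\alpha+\beta)}\,\frac{\prod_{i=1}^r(a_i;q)_\ell}{\prod_{j=1}^s(b_j;q)_\ell}.$$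 Standing assumption: $a_iq^\ell\ne1$ and $b_jq^\ell\neq1$ for all $i,j$ and all integers $\ell\ge0$. The $q$-derivative is $(D_{z,q}f)(z)=\frac{f(z)-f(qz)}{(1-q)z}$ ($z\neq0$). Notation: ${}_rR_{s,q}(a_iq)$ (resp. ${}_rR_{s,q}(b_jq^{-1})$) is the same function with only $a_i$ replaced by $a_iq$ (resp. only $b_j$ by $b_jq^{-1}$); ${}_rR_{s,q}(qz)$ is it with only $z$ replaced by $qz$. Note that $a_i$ and $b_j$ serve both as parameters of ${}_rR_{s,q}$ and as exponents.
   Formalization: Formalized with the branches assumed compatible at z, log(qz) = log q + log z (otherwise (qz)^μ = q^μ z^μ can fail), the series assumed convergent at z, a_i ≠ 0 for the a_i-forms, and b_j ≠ 0 and b_j q^{l-1} ≠ 1 for all l ≥ 0 for the b_j-forms. *)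

(* Defs.v *)
(* Stdlib reals with Coquelicot's complex numbers. *)
From Stdlib Require Import Reals ZArith Arith ClassicalEpsilon.
From Coquelicot Require Import Coquelicot.

Open Scope C_scope.

Definition Cexp (z : C) : C :=
  RtoC (exp (Re z)) * (cos (Im z), sin (Im z)).

(* A branch of the logarithm is an arbitrary choice of a logarithm of every
   nonzero number; no continuity is needed, so every cut is allowed. *)
Definition log_branch (L : C -> C) : Prop :=
  forall w : C, w <> 0 -> Cexp (L w) = w.

Definition cpow (L : C -> C) (w mu : C) : C := Cexp (mu * L w).

Definition CpowZ (w : C) (n : Z) : C :=
  match n with
  | Z0 => 1
  | Zpos p => w ^ Pos.to_nat p
  | Zneg p => / (w ^ Pos.to_nat p)
  end.

(* Total limit of a complex sequence: the limit when there is one. *)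
Definition Clim_seq (u : nat -> C) : C :=
  @lim C_CompleteNormedModule (filtermap u eventually).

Definition CSeries (u : nat -> C) : C := Clim_seq (sum_n u).

(* f 0 * ... * f (n - 1) *)
Fixpoint Cprod (f : nat -> C) (n : nat) : C :=
  match n with
  | O => 1
  | S m => Cprod f m * f m
  end.

Definition qpoch (q a : C) (n : nat) : C := Cprod (fun i => 1 - a * q ^ i) n.

Definition qpoch_inf (q a : C) : C := Clim_seq (qpoch q a).

(* Below, L is the branch used for the powers of the constants q and 1 - q. *)

Definition qnum (L : C -> C) (q mu : C) : C := (1 - cpow L q mu) / (1 - q).

Definition qGamma (L : C -> C) (q x : C) : C :=
  qpoch_inf q q / qpoch_inf q (cpow L q x) * cpow L (1 - q) (1 - x).

(* 1 / Gamma_q, with value 0 at the poles of Gamma_q. *)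
Definition inv_qGamma (L : C -> C) (q x : C) : C :=
  if excluded_middle_informative (qpoch_inf q (cpow L q x) = 0)
  then 0 else / qGamma L q x.

(* The parameters a_1, ..., a_r are the values a 0, ..., a (r - 1), and
   similarly for b_1, ..., b_s; the other values of a and b are irrelevant.
   The exponent 1 + s - r may be negative. *)
Definition rRs_term (L : C -> C) (q : C) (r s : nat) (a b : nat -> C)
    (alpha beta z : C) (l : nat) : C :=
  let e := (1 + Z.of_nat s - Z.of_nat r)%Z in
  (z ^ l * CpowZ (- (1)) (e * Z.of_nat l)
     * CpowZ q (e * Z.of_nat (l * (l - 1) / 2)))
  / qpoch q q l
  * inv_qGamma L q (RtoC (INR l) * alpha + beta)
  * (Cprod (fun i => qpoch q (a i) l) r / Cprod (fun j => qpoch q (b j) l) s).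

Definition rRs (L : C -> C) (q : C) (r s : nat) (a b : nat -> C)
    (alpha beta z : C) : C :=
  CSeries (rRs_term L q r s a b alpha beta z).

Definition rRs_converges (L : C -> C) (q : C) (r s : nat) (a b : nat -> C)
    (alpha beta z : C) : Prop :=
  @ex_series C_AbsRing C_NormedModule (rRs_term L q r s a b alpha beta z).

Definition qderiv (q : C) (f : C -> C) (z : C) : C :=
  (f z - f (q * z)) / ((1 - q) * z).

Definition upd (a : nat -> C) (i : nat) (x : C) : nat -> C :=
  fun k => if Nat.eqb k i then x else a k.

(* Main.v *)
Require Import Defs.
From Stdlib Require Import Reals ZArith Arith Lra Lia FunctionalExtensionality.
From Coquelicot Require Import Coquelicot.

(** Write [R = sum t_l] for the function at [z], so that its value at [q z] is
    [sum q^l t_l].  The eight formulas all come from two facts.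

    First, since [(q z)^mu = q^mu z^mu],
    [D_q (z^mu F) = z^(mu-1) (F(z) - q^mu F(q z)) / (1 - q)]
    ([qderiv_cpow_mul]).

    Second, shifting a single parameter multiplies [t_l] by a factor that is
    affine in [q^l].  From
    [(1 - x) (x q; q)_l = (1 - x q^l) (x; q)_l] one gets the factor
    [(1 - x q^l) / (1 - x) = 1 + x / (1 - x) * (1 - q^l)], with [x = a_i] when
    [a_i] becomes [a_i q], and with [x = b_j / q] when [b_j] becomes [b_j / q],
    because the Pochhammer symbol is then in the denominator.  Summing over [l],
    [(1 - x) / x * (shifted function - R) = R(z) - R(q z)]
    in both cases ([rRs_a_shift], [rRs_b_shift]).  Each formula is the first
    fact with [R(q z)] eliminated, wholly or in part, by the second.

    The only analytic point is that the series at [q z] converges whenever the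
    one at [z] does, even conditionally: the terms [t_l] are bounded, so
    [sum q^l t_l] is dominated by a geometric series. *)

Open Scope C_scope.

(** * Complex powers *)

Lemma Cpow_S (w : C) (n : nat) : w ^ S n = w * w ^ n.
Proof. reflexivity. Qed.

Lemma Cexp_plus (x y : C) : Cexp (x + y) = Cexp x * Cexp y.
Proof.
  unfold Cexp. destruct x as [x1 x2], y as [y1 y2]; simpl.
  rewrite exp_plus, cos_plus, sin_plus.
  apply injective_projections; simpl; ring.
Qed.

Lemma cpow_S (L : C -> C) (w mu : C) :
  log_branch L -> w <> 0 -> cpow L w mu = w * cpow L w (mu - 1).
Proof.
  intros HL Hw. unfold cpow.
  rewrite <- (HL w Hw) at 2. rewrite <- Cexp_plus. f_equal. ring.
Qed.

(** * Series *)

(** [Clim_seq] is defined through the limit operator of complete spaces, which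
    is known to be a limit only for a Cauchy filter; convergence gives this, and
    uniqueness of limits identifies the value. *)
Lemma CSeries_correct (u : nat -> C) (l : C) :
  @is_series C_AbsRing C_NormedModule u l -> CSeries u = l.
Proof.
  intros H. unfold CSeries, Clim_seq.
  apply (@filterlim_locally_unique nat C_AbsRing C_NormedModule eventually _ (sum_n u)); [ | exact H ].
  apply filterlim_locally. intros eps.
  apply (@complete_cauchy C_CompleteNormedModule (filtermap (sum_n u) eventually)).
  - apply filtermap_proper_filter, eventually_filter.
  - intros eps'. exists l. apply (proj1 (filterlim_locally (sum_n u) l) H eps').
Qed.

(** The terms of a convergent series are eventually bounded by 1, so
    multiplying by [q ^ l] yields an absolutely convergent series even if the
    original one converges only conditionally, as a power series may on its
    circle of convergence. *)
Lemma ex_series_mul_geom (q : C) (t : nat -> C) :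
  (Cmod q < 1)%R ->
  @ex_series C_AbsRing C_NormedModule t ->
  @ex_series C_AbsRing C_NormedModule (fun l => q ^ l * t l).
Proof.
  intros Hq Ht.
  destruct (@Cauchy_ex_series C_AbsRing C_CompleteNormedModule t Ht (mkposreal 1 Rlt_0_1)) as [N HN].
  apply (@ex_series_incr_n C_AbsRing C_NormedModule _ N).
  apply (@ex_series_le C_AbsRing C_CompleteNormedModule _ (fun k => (Cmod q ^ k)%R)).
  - intros k. change (Cmod (q ^ (N + k) * t (N + k)%nat) <= Cmod q ^ k)%R.
    assert (Hk : (Cmod (t (N + k)%nat) < 1)%R).
    { generalize (HN (N + k)%nat (N + k)%nat).
      rewrite sum_n_n. intros H; apply H; apply Nat.le_add_r. }
    rewrite Cmod_mult, Cmod_pow, pow_add.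
    assert (0 <= Cmod q ^ k)%R by apply pow_le, Cmod_ge_0.
    assert (0 <= Cmod q ^ N <= 1)%R.
    { split; [ apply pow_le, Cmod_ge_0 | ].
      rewrite <- (pow1 N). apply pow_incr. split; [ apply Cmod_ge_0 | lra ]. }
    pose proof (Cmod_ge_0 (t (N + k)%nat)).
    assert (Cmod q ^ N * Cmod q ^ k * Cmod (t (N + k)%nat) <= 1 * Cmod q ^ k * 1)%R; [ | lra ].
    apply Rmult_le_compat; try nra.
  - apply ex_series_geom. rewrite Rabs_pos_eq; [ exact Hq | apply Cmod_ge_0 ].
Qed.

(** The summed form of a parameter shift: a factor [1 + k (1 - q ^ l)] on the
    terms turns into [k] times a difference of sums; when [t] collects the terms of a
    power series at [z], that is its value at [z] minus its value at [q z]. *)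
Lemma CSeries_qdiff (q k : C) (t u : nat -> C) :
  (Cmod q < 1)%R ->
  @ex_series C_AbsRing C_NormedModule t ->
  (forall l, u l = t l + k * (t l - q ^ l * t l)) ->
  CSeries u = CSeries t + k * (CSeries t - CSeries (fun l => q ^ l * t l)).
Proof.
  intros Hq Ht Hu.
  destruct (ex_series_mul_geom q t Hq Ht) as [y Hy]. destruct Ht as [x Hx].
  rewrite (CSeries_correct _ _ Hx), (CSeries_correct _ _ Hy).
  apply CSeries_correct.
  apply (is_series_ext (fun l => plus (t l) (scal k (minus (t l) (q ^ l * t l))))).
  - intros l. rewrite Hu. reflexivity.
  - apply (is_series_plus _ _ _ _ Hx), (is_series_scal _ _ _ (is_series_minus _ _ _ _ Hx Hy)).
Qed.

(** * Products and q-shifted factorials *)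

(** Both sides are the product of [1 - x q^i] for [i] from [0] to [l]. *)
Lemma qpoch_shift (q x : C) (l : nat) :
  (1 - x) * qpoch q (x * q) l = (1 - x * q ^ l) * qpoch q x l.
Proof.
  unfold qpoch. induction l as [|l IH]; simpl Cprod.
  - simpl. ring.
  - rewrite Cmult_assoc, IH, Cpow_S. ring.
Qed.

Lemma Cprod_ext (f g : nat -> C) (n : nat) :
  (forall k, (k < n)%nat -> f k = g k) -> Cprod f n = Cprod g n.
Proof.
  induction n as [|n IH]; intros H; simpl; [ reflexivity | ].
  rewrite IH, H; auto with arith.
Qed.

(** The multiplicative relation between the old and the new factor is kept
    free of division, so that one lemma serves both the numerator parameters,
    with [x = a i * q], and the denominator ones, with [x = b j / q]. *)
Lemma Cprod_upd (g : C -> C) (a : nat -> C) (i n : nat) (x c d : C) :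
  (i < n)%nat -> c * g x = d * g (a i) ->
  c * Cprod (fun k => g (upd a i x k)) n = d * Cprod (fun k => g (a k)) n.
Proof.
  intros Hi Hg. induction n as [|n IH]; [ now apply Nat.nlt_0_r in Hi | ].
  simpl. destruct (Nat.eq_dec i n) as [->|Hne].
  - rewrite (Cprod_ext (fun k => g (upd a n x k)) (fun k => g (a k))).
    + unfold upd. rewrite Nat.eqb_refl.
      transitivity (Cprod (fun k => g (a k)) n * (c * g x)); [ ring | rewrite Hg; ring ].
    + intros k Hk. unfold upd. apply Nat.lt_neq, Nat.eqb_neq in Hk. now rewrite Hk.
  - rewrite !Cmult_assoc, IH.
    + unfold upd at 1. apply Nat.neq_sym, Nat.eqb_neq in Hne. now rewrite Hne.
    + lia.
Qed.

Lemma Cprod_neq_0 (f : nat -> C) (n : nat) :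
  (forall k, (k < n)%nat -> f k <> 0) -> Cprod f n <> 0.
Proof.
  induction n as [|n IH]; intros H; simpl; [ exact C1_nz | ].
  apply Cmult_neq_0; auto with arith.
Qed.

Lemma C1_minus_neq_0 (x : C) : x <> 1 -> 1 - x <> 0.
Proof.
  intros H E. apply H. replace x with (1 - (1 - x)) by ring. rewrite E. ring.
Qed.

(** * The function with one shifted parameter *)

Lemma rRs_qz (L : C -> C) (q : C) (r s : nat) (a b : nat -> C)
    (alpha beta z : C) :
  rRs L q r s a b alpha beta (q * z)
  = CSeries (fun l => q ^ l * rRs_term L q r s a b alpha beta z l).
Proof.
  unfold rRs. f_equal.
  apply functional_extensionality; intros l.
  unfold rRs_term. rewrite Cpow_mult_l. unfold Cdiv. ring.
Qed.

(** The shift multiplies the [l]-th term by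
    [(1 - a i * q ^ l) / (1 - a i)], that is, by
    [1 + a i / (1 - a i) * (1 - q ^ l)]. *)
Lemma rRs_a_shift (L : C -> C) (q : C) (r s : nat) (a b : nat -> C)
    (alpha beta z : C) (i : nat) :
  (Cmod q < 1)%R -> rRs_converges L q r s a b alpha beta z ->
  (i < r)%nat -> a i <> 0 -> a i <> 1 ->
  (1 - a i) / a i
    * (rRs L q r s (upd a i (a i * q)) b alpha beta z
       - rRs L q r s a b alpha beta z)
  = rRs L q r s a b alpha beta z - rRs L q r s a b alpha beta (q * z).
Proof.
  intros Hq Hcv Hi Ha0 Ha1. apply C1_minus_neq_0 in Ha1.
  rewrite rRs_qz. unfold rRs at 1.
  rewrite (CSeries_qdiff q (a i / (1 - a i)) (rRs_term L q r s a b alpha beta z)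
             _ Hq Hcv).
  - fold (rRs L q r s a b alpha beta z). field. now split.
  - intros l. unfold rRs_term.
    pose proof (Cprod_upd (fun x => qpoch q x l) a i r (a i * q) (1 - a i)
      (1 - a i * q ^ l) Hi (qpoch_shift q (a i) l)) as H.
    simpl in H.
    set (P' := Cprod (fun k => qpoch q (upd a i (a i * q) k) l) r) in *.
    set (P := Cprod (fun k => qpoch q (a k) l) r) in *.
    replace P' with ((1 - a i * q ^ l) * P / (1 - a i))
      by (rewrite <- H; field; exact Ha1).
    unfold Cdiv. set (B := / Cprod _ s). set (D := / qpoch q q l).
    field. exact Ha1.
Qed.

(** With [x = b j / q] one has [b j = x q], so replacing [b j] by [x] undoes
    the shift of [qpoch_shift]; in the denominator this multiplies the [l]-th
    term by the same [(1 - x * q ^ l) / (1 - x)] as for a numerator parameter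
    [x]. *)
Lemma rRs_b_shift (L : C -> C) (q : C) (r s : nat) (a b : nat -> C)
    (alpha beta z : C) (j : nat) :
  (Cmod q < 1)%R -> rRs_converges L q r s a b alpha beta z ->
  (j < s)%nat -> q <> 0 -> b j <> 0 ->
  (forall k l : nat, (k < s)%nat -> b k * q ^ l <> 1) ->
  (forall l : nat, b j * / q * q ^ l <> 1) ->
  (1 - b j * / q) / (b j * / q)
    * (rRs L q r s a (upd b j (b j * / q)) alpha beta z
       - rRs L q r s a b alpha beta z)
  = rRs L q r s a b alpha beta z - rRs L q r s a b alpha beta (q * z).
Proof.
  intros Hq Hcv Hj Hq0 Hb0 Hb Hbq.
  assert (Hx1 : 1 - b j * / q <> 0).
  { apply C1_minus_neq_0. generalize (Hbq O). simpl. now rewrite Cmult_1_r. }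
  assert (Hx : b j = b j * / q * q) by (field; exact Hq0).
  assert (Hx0 : b j * / q <> 0) by (intros E; rewrite E in Hx; apply Hb0; rewrite Hx; ring).
  set (x := b j * / q) in *.
  rewrite rRs_qz. unfold rRs at 1.
  rewrite (CSeries_qdiff q (x / (1 - x)) (rRs_term L q r s a b alpha beta z)
             _ Hq Hcv).
  - fold (rRs L q r s a b alpha beta z). field. now split.
  - intros l. unfold rRs_term.
    assert (Hl : 1 - x * q ^ l <> 0) by apply C1_minus_neq_0, Hbq.
    assert (HP : Cprod (fun k => qpoch q (b k) l) s <> 0).
    { apply Cprod_neq_0; intros k Hk. apply Cprod_neq_0; intros m _.
      now apply C1_minus_neq_0, Hb. }
    assert (Hshift : (1 - x * q ^ l) * qpoch q x l = (1 - x) * qpoch q (b j) l).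
    { rewrite Hx. symmetry. apply qpoch_shift. }
    pose proof (Cprod_upd (fun x => qpoch q x l) b j s x _ _ Hj Hshift) as H.
    simpl in H.
    set (P' := Cprod (fun k => qpoch q (upd b j x k) l) s) in *.
    set (P := Cprod (fun k => qpoch q (b k) l) s) in *.
    replace P' with ((1 - x) * P / (1 - x * q ^ l))
      by (rewrite <- H; field; exact Hl).
    unfold Cdiv. set (D := / qpoch q q l).
    field. repeat split; assumption.
Qed.

(** * The q-derivative of a power times a function *)

(** The branch condition on [Lz] at [q * z] is what makes
    [(q z)^mu = q^mu z^mu] hold. *)
Lemma qderiv_cpow_mul (q z mu : C) (L Lz F : C -> C) :
  1 - q <> 0 -> z <> 0 -> log_branch Lz -> Lz (q * z) = L q + Lz z ->
  qderiv q (fun w => cpow Lz w mu * F w) z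
  = cpow Lz z (mu - 1) * ((F z - cpow L q mu * F (q * z)) / (1 - q)).
Proof.
  intros Hq1 Hz HLz Hbr. unfold qderiv.
  assert (E : cpow Lz (q * z) mu = cpow L q mu * cpow Lz z mu).
  { unfold cpow. rewrite Hbr, Cmult_plus_distr_l. apply Cexp_plus. }
  rewrite E, (cpow_S Lz z mu HLz Hz). field. now split.
Qed.

Theorem theorem10 :
  forall (q : C) (L Lz : C -> C) (r s : nat) (a b : nat -> C)
         (alpha beta z : C) (i j : nat),
    q <> 0 -> (Cmod q < 1)%R ->
    log_branch L -> log_branch Lz ->
    (1 <= r)%nat -> (1 <= s)%nat ->
    (forall k l : nat, (k < r)%nat -> a k * q ^ l <> 1) ->
    (forall k l : nat, (k < s)%nat -> b k * q ^ l <> 1) ->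
    z <> 0 ->
    Lz (q * z) = L q + Lz z ->
    rRs_converges L q r s a b alpha beta z ->
    (i < r)%nat -> (j < s)%nat ->
    let ai := a i in
    let bj := b j in
    let F := fun w : C => rRs L q r s a b alpha beta w in
    let R := F z in
    let Ra := rRs L q r s (upd a i (ai * q)) b alpha beta z in
    let Rb := rRs L q r s a (upd b j (bj * / q)) alpha beta z in
    let Da := qderiv q (fun w => cpow Lz w ai * F w) z in
    let Db := qderiv q (fun w => cpow Lz w (bj - 1) * F w) z in
    (* conditions under which the right-hand sides with a_i q, respectively
       b_j q^{-1}, are defined *)
    let okA := ai <> 0 in
    let okB := bj <> 0 /\ (forall l : nat, bj * / q * q ^ l <> 1) in
    (* (1) *)
    ((okA ->
      Da = (1 - cpow L q ai) / (1 - q) * cpow Lz z (ai - 1) * R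
           + (1 - ai) / ((1 - q) * ai) * cpow L q ai * cpow Lz z (ai - 1)
             * (Ra - R)) /\
     (okB ->
      Da = (1 - cpow L q ai) / (1 - q) * cpow Lz z (ai - 1) * R
           + (1 - bj * / q) / ((1 - q) * (bj * / q))
             * cpow L q ai * cpow Lz z (ai - 1) * (Rb - R))) /\
    (* (2) *)
    ((okA ->
      Da = cpow Lz z (ai - 1) * ((1 - ai) / ((1 - q) * ai)) * (Ra - R)
           + (1 - cpow L q ai) / (1 - q) * cpow Lz z (ai - 1) * F (q * z)) /\
     (okB ->
      Da = cpow Lz z (ai - 1)
             * ((1 - bj * / q) / ((1 - q) * (bj * / q))) * (Rb - R)
           + (1 - cpow L q ai) / (1 - q) * cpow Lz z (ai - 1) * F (q * z))) /\
    (* (3) *)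
    ((okA ->
      Db = cpow Lz z (bj - 2)
           * (qnum L q (bj - 1) * R
              + (1 - ai) * cpow L q (bj - 1) / ((1 - q) * ai) * (Ra - R))) /\
     (okB ->
      Db = cpow Lz z (bj - 2)
           * (qnum L q (bj - 1) * R
              + (1 - bj * / q) * cpow L q (bj - 1) / ((1 - q) * (bj * / q))
                * (Rb - R)))) /\
    (* (4) *)
    ((okA ->
      Db = cpow Lz z (bj - 2)
           * ((1 - ai) / ((1 - q) * ai) * (Ra - R)
              + qnum L q (bj - 1) * F (q * z))) /\
     (okB ->
      Db = cpow Lz z (bj - 2)
           * ((1 - bj * / q) / ((1 - q) * (bj * / q)) * (Rb - R)
              + qnum L q (bj - 1) * F (q * z)))).
Proof.
  intros q L Lz r s a b alpha beta z i j Hq0 Hq HL HLz Hr Hs Ha Hb Hz Hbr Hcv Hi Hj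
    ai bj F R Ra Rb Da Db okA okB.
  assert (Hq1 : 1 - q <> 0).
  { apply C1_minus_neq_0. intros E. rewrite E, Cmod_1 in Hq. lra. }
  assert (HDa := qderiv_cpow_mul q z ai L Lz F Hq1 Hz HLz Hbr).
  assert (HDb := qderiv_cpow_mul q z (bj - 1) L Lz F Hq1 Hz HLz Hbr).
  replace (bj - 1 - 1) with (bj - 2) in HDb by ring.
  fold Da in HDa. fold Db in HDb. fold R in HDa, HDb.
  assert (HA : okA -> F (q * z) = R - (1 - ai) / ai * (Ra - R)).
  { intros H. unfold Ra, R, F, ai. rewrite rRs_a_shift; try assumption; [ ring | ].
    generalize (Ha i O Hi). simpl. now rewrite Cmult_1_r. }
  assert (HB : okB ->
    F (q * z) = R - (1 - bj * / q) / (bj * / q) * (Rb - R)).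
  { intros [H1 H2]. unfold Rb, R, F, bj.
    rewrite rRs_b_shift; try assumption. ring. }
  clearbody Da Db F R Ra Rb.
  rewrite HDa, HDb. unfold qnum.
  repeat split; intros H; (rewrite (HA H) || rewrite (HB H));
    field; unfold okA, okB in H; intuition.
Qed.
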